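(* Let $\lambda=(a,\rho,1^t)$ be a partition, where $t\ge0$, $\rho$ is a nonempty partition all of whose parts are at least $2$, and $a\ge\rho_1$. Then $\lambda$ lies in the node-moving closure of the set of long-first-row partitions if and only if $$a+t\ge|\rho|+C(\rho)-1 .$$
   Context: For a nonempty partition $\rho$, $C(\rho)=\max\{\rho_i-i:\rho_i>\rho_{i+1}\}$ (with $\rho_{\ell+1}=0$ past the last part), i.e. the largest content (column minus row) of a removable box. A long-first-row partition is one of the form $(m,\sigma)=(m,\sigma_1,\sigma_2,\dots)$ with $\sigma$ a nonempty partition, $m\ge\sigma_1$ and $m\ge|\sigma|+C(\sigma)-1$. A node move on a partition removes an outer (removable) box from a row of length greater than one and appends a new row of length one, so the total size is preserved and the result is again a partition. The node-moving closure of a set of partitions is the set of all partitions obtained from its members by finite (possibly empty) sequences of node moves. $(a,\rho,1^t)$ denotes the partition with parts $a$, the parts of $\rho$, and $t$ ones. *)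

(* Defs.v *)
From mathcomp Require Import all_boot all_order all_algebra zify.

Set Implicit Arguments.
Unset Strict Implicit.
Unset Printing Implicit Defensive.

Import Order.TTheory GRing.Theory Num.Theory.

(* A partition is the weakly decreasing sequence of its (positive) parts.
   Rows are indexed from 0, so rho_i is nth 0 rho i.-1, and nth returns 0 past
   the last part. *)
Definition is_partition (rho : seq nat) : bool :=
  sorted geq rho && all (leq 1) rho.

Definition removable_row (rho : seq nat) (k : nat) : bool :=
  nth 0 rho k.+1 < nth 0 rho k.

Definition end_content (rho : seq nat) (k : nat) : int :=
  ((nth 0 rho k)%:Z - k.+1%:Z)%R.

(* Contents can be negative, so the maximum is taken in int. The default value
   - size rho lies strictly below the content of every box of rho, hence it does
   not affect the maximum when rho is nonempty (see max_content_attained). *)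
Definition max_content (rho : seq nat) : int :=
  \big[Order.max/ (- (size rho)%:Z)%R]_(k < size rho | removable_row rho k)
     end_content rho k.

Definition long_first_row (lambda : seq nat) : Prop :=
  exists (m : nat) (sigma : seq nat),
    [/\ lambda = m :: sigma,
        sigma != [::],
        is_partition sigma,
        nth 0 sigma 0 <= m
      & ((sumn sigma)%:Z + max_content sigma - 1 <= m%:Z)%R].

Definition node_move : rel (seq nat) := fun mu nu =>
  [exists k : 'I_(size mu),
     [&& removable_row mu k, 1 < nth 0 mu k
       & nu == rcons (set_nth 0 mu k (nth 0 mu k).-1) 1]].

Definition node_moving_closure (P : seq nat -> Prop) (lambda : seq nat) : Prop :=
  exists (mu : seq nat) (s : seq (seq nat)),
    [/\ P mu, path node_move mu s & lambda = last mu s].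

Lemma max_content_ge (rho : seq nat) (k : nat) :
  k < size rho -> removable_row rho k ->
  (end_content rho k <= max_content rho)%R.
Proof.
move=> lt_k rem_k; rewrite /max_content.
exact: (le_bigmax_cond _ (fun i : 'I_(size rho) => end_content rho i)
          (j := Ordinal lt_k)).
Qed.

Lemma max_content_attained (rho : seq nat) :
  rho != [::] -> is_partition rho ->
  exists2 k, k < size rho & removable_row rho k /\
                            max_content rho = end_content rho k.
Proof.
move=> rho_n0 /andP[_ /allP pos_rho].
have sz_gt0 : 0 < size rho by rewrite lt0n size_eq0.
have lt_last : (size rho).-1 < size rho by rewrite prednK.
have last_gt0 : 0 < nth 0 rho (size rho).-1 by apply/pos_rho/mem_nth.
have rem_last : removable_row rho (size rho).-1.
  by rewrite /removable_row prednK // nth_default.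
have: max_content rho = (- (size rho)%:Z)%R \/
      exists2 k, k < size rho & removable_row rho k /\
                                max_content rho = end_content rho k.
  rewrite /max_content; elim/big_ind: _ => [|x y Hx Hy|k rem_k].
  - by left.
  - by rewrite /Order.max; case: ifP.
  - by right; exists k.
case=> // max_def; have := max_content_ge lt_last rem_last.
rewrite max_def /end_content prednK // lerBlDr addNr.
by rewrite lez_nat leqNgt last_gt0.
Qed.

Lemma node_move_partition (mu nu : seq nat) :
  is_partition mu -> node_move mu nu ->
  is_partition nu /\ sumn nu = sumn mu.
Proof.
move=> /andP[/(sortedP 0) srt_mu /(all_nthP 0) pos_mu].
case/existsP=> -[k lt_k] /= /and3P[rem_k gt1 /eqP->].
set mu' := set_nth _ _ _ _.
have sz_mu' : size mu' = size mu by rewrite size_set_nth; apply/maxn_idPr.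
have pos_mu' i : i < size mu -> 0 < nth 0 mu' i.
  move=> lt_i; rewrite nth_set_nth /=; case: eqP => _; last exact: pos_mu.
  by case: (nth 0 mu k) gt1 => [|[]].
split; last first.
  have le_sum : nth 0 mu k <= sumn mu.
    rewrite -{2}(cat_take_drop k mu) sumn_cat (drop_nth 0) //= addnCA.
    exact: leq_addr.
  rewrite sumn_rcons sumn_set_nth0 addn1.
  by case: (nth 0 mu k) gt1 le_sum => //= p _ lt_p; lia.
apply/andP; split; last first.
  rewrite all_rcons /=; apply/(all_nthP 0) => i; rewrite sz_mu'; exact: pos_mu'.
apply/(sortedP 0) => i; rewrite size_rcons sz_mu' ltnS => lt_i.
rewrite !nth_rcons sz_mu' lt_i /geq /=.
case: ltnP => [lt_i1|_]; last by case: ifP => _; rewrite ?pos_mu'.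
rewrite !nth_set_nth /=; have := srt_mu i lt_i1; rewrite /geq /= => le_i.
case: (eqVneq i k) => [->|ne_i].
  rewrite eqn_leq ltnn /=; move: rem_k; rewrite /removable_row.
  by case: (nth 0 mu k).
case: eqP => // <-; exact: leq_trans (leq_pred _) le_i.
Qed.

(* Main.v *)
Require Import Defs.
From mathcomp Require Import all_boot all_order all_algebra zify.

(** Write [n] for the size of a partition, which node moves preserve. For
    [(a, rho, 1^t)] the inequality of the theorem says that
    [n + C(rho) - 1 <= 2 (a + t)]. Moving a box out of the first row does not
    change [a + t]; moving a box out of a lower row raises [t] and increases
    [C(rho)] by at most one. Hence the inequality propagates from long-first-row
    partitions to their closure. Conversely, [(a, rho, 1^t)] is reached from
    [(a + t, rho)] by [t] moves out of the first row. *)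

(* The default [0] of [nth] in [end_content] is the zero of the semiring [nat];
   it is replaced here by the literal [0], which [lia] recognizes. *)
Lemma end_contentE (rho : seq nat) (k : nat) :
  end_content rho k = ((nth 0%N rho k)%:Z - k.+1%:Z)%R.
Proof. by []. Qed.

(* Quantifying over the corners of [mu] below the first row, in rows of length
   at least two, makes sense of the inequality without splitting [mu]. *)
Definition corner_bounded (mu : seq nat) : Prop :=
  forall k, 0 < k -> removable_row mu k -> 1 < nth 0 mu k ->
    sumn mu + nth 0 mu k <= 2 * (nth 0 mu 0 + count_mem 1 mu) + k.+1.

Lemma long_first_row_corner_bounded (mu : seq nat) :
  long_first_row mu -> corner_bounded mu.
Proof.
case=> m [sigma [-> _ _ _ long]] [//|k] _ rem_k gt1.
have lt_k : k < size sigma.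
  by rewrite ltnNge; apply: contraL gt1 => ?; rewrite /= nth_default.
have := max_content_ge (rho := sigma) lt_k rem_k.
by move: long; rewrite end_contentE /=; lia.
Qed.

Lemma sumn_node_move (mu : seq nat) (j : nat) :
  0 < nth 0 mu j -> sumn (rcons (set_nth 0 mu j (nth 0 mu j).-1) 1) = sumn mu.
Proof.
move=> gt0.
have le_sum : nth 0 mu j <= sumn mu.
  have [lt_j|ge_j] := ltnP j (size mu); last by rewrite nth_default.
  by rewrite -{2}(cat_take_drop j mu) sumn_cat (drop_nth 0) //= addnCA leq_addr.
by rewrite sumn_rcons sumn_set_nth0; lia.
Qed.

(** The shortened row had length at least two, so no row of length one is lost, and one is
    appended. *)
Lemma count_node_move (mu : seq nat) (j : nat) :
  j < size mu -> 1 < nth 0 mu j ->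
  count_mem 1 mu < count_mem 1 (rcons (set_nth 0 mu j (nth 0 mu j).-1) 1).
Proof.
elim: mu j => [|x mu IH] [|j] //= lt_j gt1.
  by rewrite -cats1 count_cat /=; lia.
by have := IH j lt_j gt1; rewrite /=; lia.
Qed.

Lemma node_move_corner_bounded (mu nu : seq nat) :
  node_move mu nu -> corner_bounded mu -> corner_bounded nu.
Proof.
case/existsP=> -[j lt_j] /= /and3P[rem_j gt1 /eqP nuE] bnd k k_gt0.
have sum_nu : sumn nu = sumn mu by rewrite nuE sumn_node_move // ltnW.
have cnt_nu : count_mem 1 mu < count_mem 1 nu by rewrite nuE count_node_move.
have nth_nu i : nth 0 nu i = if i < size mu then nth 0 mu i - (i == j)
                             else (i == size mu).
  rewrite nuE nth_rcons size_set_nth (maxn_idPr lt_j) nth_set_nth /=.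
  case: ltnP => // _.
  by case: eqP => [->|_]; rewrite ?subn1 ?subn0.
have nth_past i : size mu <= i -> nth 0 mu i = 0 by exact: nth_default.
have mu_gt0 : 0 < size mu by exact: leq_ltn_trans lt_j.
move: rem_j; rewrite /removable_row sum_nu => rem_j rem_k gt1k.
have lt_k : k < size mu.
  by move: gt1k; rewrite nth_nu; case: (ltnP k) => // _; case: eqP.
have nu0 := nth_nu 0; have nuk := nth_nu k; have nuk1 := nth_nu k.+1.
have pastk1 := nth_past k.+1.
rewrite mu_gt0 in nu0; rewrite lt_k in nuk.
have bndk := bnd k k_gt0; have bndj := bnd j.
rewrite /removable_row in bndk bndj.
have [j0|j_gt0] := posnP j.
  by subst j; move: nuk1; case: (ltnP k.+1) => ?; lia.
have {bndj} := bndj j_gt0 rem_j gt1.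
have [kj|ne_kj] := eqVneq k j; first by subst k; lia.
have [k1j|ne_k1j] := eqVneq k.+1 j; last first.
  by move: nuk1; case: (ltnP k.+1) => ?; lia.
subst j; rewrite lt_j eqxx in nuk1.
(* Either row [k] was already a corner, or it is no longer than row [k.+1]: its content then exceeds
   that of the old corner [k.+1] by at most one, which the new row of length one pays for. *)
have [lt|ge] := ltnP (nth 0 mu k.+1) (nth 0 mu k); last by lia.
by have := bndk lt; lia.
Qed.

Lemma closure_corner_bounded (lambda : seq nat) :
  node_moving_closure long_first_row lambda -> corner_bounded lambda.
Proof.
case=> mu [s [/long_first_row_corner_bounded bnd pth ->]].
elim: s mu bnd pth => //= nu s IH mu bnd /andP[mv]; apply: IH.
exact: node_move_corner_bounded bnd.
Qed.

Lemma node_moving_closure_step (P : seq nat -> Prop) (mu nu : seq nat) :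
  node_moving_closure P mu -> node_move mu nu -> node_moving_closure P nu.
Proof.
case=> mu0 [s [Pmu0 pth ->]] mv; exists mu0, (rcons s nu).
by rewrite rcons_path pth last_rcons.
Qed.

Lemma node_move_first_row (a : nat) (tau : seq nat) :
  0 < a -> nth 0 tau 0 <= a -> node_move (a.+1 :: tau) (a :: rcons tau 1).
Proof.
move=> a_gt0 le_a; apply/existsP; exists ord0.
by rewrite /removable_row /= !ltnS le_a a_gt0 /=.
Qed.

Theorem proposition9p2 (a t : nat) (rho : seq nat)
  (rho_nonempty : rho != [::])
  (rho_partition : is_partition rho)
  (rho_parts_ge2 : all (leq 2) rho)
  (rho1_le_a : nth 0 rho 0 <= a) :
  node_moving_closure long_first_row (a :: rho ++ nseq t 1) <->
  ((sumn rho)%:Z + max_content rho - 1 <= (a + t)%:Z)%R.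
Proof.
have sz_gt0 : 0 < size rho by rewrite lt0n size_eq0.
have a_gt1 : 1 < a.
  by apply: leq_trans rho1_le_a; exact: (all_nthP 0 rho_parts_ge2).
split=> [/closure_corner_bounded bnd|].
  have [k lt_k [rem_k ->]] := max_content_attained rho_nonempty rho_partition.
  have ge2 : 1 < nth 0 rho k by exact: (all_nthP 0 rho_parts_ge2).
  have rem : removable_row (a :: rho ++ nseq t 1) k.+1.
    rewrite /removable_row /= !nth_cat lt_k.
    case: (ltnP k.+1) => _; first exact: rem_k.
    (* Below the last row of [rho] comes a row of length at most one, shorter than any part of
       [rho]. *)
    by apply: leq_trans ge2; rewrite ltnS nth_nseq; case: ifP.
  have := bnd k.+1 isT rem.
  have cnt_rho : count_mem 1 rho = 0.
    apply/count_memPn/negP => /(allP rho_parts_ge2); exact/negP.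
  rewrite /= nth_cat lt_k sumn_cat sumn_nseq count_cat cnt_rho count_nseq /=.
  by rewrite end_contentE => /(_ ge2); lia.
(* Undoing a move replaces [(a, t.+1)] by [(a.+1, t)] and keeps the sum, so [a] must vary. *)
elim: t a rho1_le_a a_gt1 => [|t IH] a le_a a_gt1 long.
  rewrite cats0; exists (a :: rho), [::]; split=> //.
  by exists a, rho; split=> //; rewrite addn0 in long.
rewrite -addn1 nseqD catA cats1.
apply: node_moving_closure_step (node_move_first_row _ _ _ _); last 2 first.
- exact: ltnW.
- by rewrite nth_cat sz_gt0.
by apply: IH; rewrite ?addSnnS // leqW.
Qed.
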